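(* Let $(A,* )$ be a finite dimensional unital commutative associative algebra over $\mathbb{C}$ with identity $\hat{1}$, and let $B$ be a finite dimensional vertex $A$-algebroid such that $A$ is not a trivial module of the Leibniz algebra $B$. Let $B$ be a simple Leibniz algebra with $\mathrm{Leib}(B)\neq\{0\}$. Assume that its Levi factor is $S=\mathrm{Span}\{e,f,h\}$ with $e_0f=h$, $h_0e=2e$, $h_0f=-2f$, and $e_1f=k\hat{1}\in(\mathbb{C}\hat{1})\setminus\{0\}$. Then: (i) $e_1e=f_1f=e_1h=f_1h=0$, $k=1$, $h_1h=2\hat{1}$. (ii) $\mathrm{Ker}(\partial)=\mathbb{C}\hat{1}$. (iii) $\mathrm{Leib}(B)$ is an irreducible $sl_2$-module of dimension 2. Moreover, as an $sl_2$-module, $A$ is a direct sum of a trivial module and an irreducible $sl_2$-module of dimension 2. (iv) $A$ is a local algebra. Let $A_{\neq 0}$ be an irreducible $sl_2$-submodule of $A$ of dimension 2, let $a_0\in A_{\neq0}$ be a highest weight vector of weight 1 and let $a_1=f_0a_0$. Then $\{a_0,a_1\}$ is a basis of $A_{\neq0}$, $\{\hat{1},a_0,a_1\}$ is a basis of $A$, and $\{\partial(a_0),\partial(a_1)\}$ is a basis of $\mathrm{Leib}(B)$. The following relations hold: $$(\partial(a_0))_1e=0,\quad (\partial(a_0))_1f=a_1,\quad (\partial(a_0))_1h=a_0,$$ $$(\partial(a_1))_1e=a_0,\quad (\partial(a_1))_1f=0,\quad (\partial(a_1))_1h=-a_1,$$ $$a_0\cdot e=0,\quad a_0\cdot f=\partial(a_1),\quad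 a_0\cdot h=\partial(a_0),\quad a_0\cdot\partial(a_i)=0\text{ for }i\in\{0,1\},$$ $$a_1\cdot e=\partial(a_0),\quad a_1\cdot f=0,\quad a_1\cdot h=-\partial(a_1),\quad a_1\cdot\partial(a_i)=0\text{ for }i\in\{0,1\},$$ $$a_i*a_j=0\text{ for all }i,j\in\{0,1\}.$$
   Context: A (left) Leibniz algebra is a vector space $\mathfrak{L}$ over $\mathbb{C}$ with a bilinear bracket satisfying $[a,[b,c]]=[[a,b],c]+[b,[a,c]]$. An ideal is a subspace $I$ with $[\mathfrak{L},I]\subseteq I$ and $[I,\mathfrak{L}]\subseteq I$. $\mathrm{Leib}(\mathfrak{L})=\mathrm{Span}\{[u,u]\mid u\in\mathfrak{L}\}$, an ideal. $\mathfrak{L}$ is simple if $[\mathfrak{L},\mathfrak{L}]\neq\mathrm{Leib}(\mathfrak{L})$ and $\{0\}$, $\mathrm{Leib}(\mathfrak{L})$, $\mathfrak{L}$ are its only ideals. $\mathrm{rad}(\mathfrak{L})$ is the maximal solvable ideal; a Levi factor is a subalgebra $S$ that is a semisimple Lie algebra with $\mathfrak{L}=S\dot{+}\mathrm{rad}(\mathfrak{L})$ (direct sum of vector spaces). Here $S\cong sl_2$ with usual basis $e,f,h$. Let $(A,* )$ be a unital commutative associative $\mathbb{C}$-algebra with identity $\hat{1}$. A vertex $A$-algebroid is a $\mathbb{C}$-vector space $B$ with: a $\mathbb{C}$-bilinear map $A\times B\to B$, $(a,v)\mapsto a\cdot v$, with $\hat 1\cdot v=v$; a Leibniz algebra bracket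 $[\ ,\ ]$ on $B$; a Leibniz algebra homomorphism $\pi:B\to \mathrm{Der}(A)$; a symmetric $\mathbb{C}$-bilinear pairing $\langle\ ,\ \rangle:B\otimes_{\mathbb{C}}B\to A$; a $\mathbb{C}$-linear map $\partial:A\to B$ with $\pi\circ\partial=0$; such that for $a,a'\in A$, $u,v,v_1,v_2\in B$: $a\cdot(a'\cdot v)-(a*a')\cdot v=\pi(v)(a)\cdot\partial(a')+\pi(v)(a')\cdot\partial(a)$; $[u,a\cdot v]=\pi(u)(a)\cdot v+a\cdot[u,v]$; $[u,v]+[v,u]=\partial(\langle u,v\rangle)$; $\pi(a\cdot v)=a\pi(v)$; $\langle a\cdot u,v\rangle=a*\langle u,v\rangle-\pi(u)(\pi(v)(a))$; $\pi(v)(\langle v_1,v_2\rangle)=\langle[v,v_1],v_2\rangle+\langle v_1,[v,v_2]\rangle$; $\partial(a*a')=a\cdot\partial(a')+a'\cdot\partial(a)$; $[v,\partial(a)]=\partial(\pi(v)(a))$; $\langle v,\partial(a)\rangle=\pi(v)(a)$. Notation: $u_0v=[u,v]$, $u_1v=\langle u,v\rangle$, $u_0a=\pi(u)(a)$ for $u,v\in B$, $a\in A$. The Leibniz algebra $B$ means $(B,[\ ,\ ])$; $A$ is a $B$-module via $u\cdot a=u_0a$, and it is trivial if $u_0a=0$ for all $u\in B,a\in A$. $A$ and $\mathrm{Leib}(B)$ are $sl_2$-modules via the operators $s_0$, $s\in S$. $\mathrm{Ker}(\partial)=\{a\in A\mid\partial(a)=0\}$. In (iv), $a_0,a_1$ denote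 vectors of $A$ (not operators). A local algebra is a commutative algebra with a unique maximal ideal. *)

(* Defs.v *)
From HB Require Import structures.
From mathcomp Require Import all_boot all_order all_algebra.
From mathcomp Require Import boolp classical_sets.
Set Implicit Arguments.
Unset Strict Implicit.
Unset Printing Implicit Defensive.
Import GRing.Theory.
Local Open Scope ring_scope.
Local Open Scope classical_set_scope.

(* The zero algebra is not an instance, since ComAlgebra requires 1 != 0. *)
#[short(type="comVectAlgType")]
HB.structure Definition ComVectAlgebra (F : fieldType) :=
  { A of GRing.ComAlgebra F A & Vector F A }.

Section Span.
Variables (F : fieldType) (L : vectType F).

Lemma span_set_exists (X : set L) :
  exists V : {vspace L}, forall v,
    v \in V <-> exists2 s : seq L, {in s, forall x, X x} & v \in <<s>>%VS.
Proof.
pose P n := `[< exists2 s : seq L, {in s, forall x, X x} & \dim <<s>> = n >].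
have P0 : exists n, P n by exists (\dim <<[::] : seq L>>); apply/asboolP; exists [::].
have ubP n : P n -> (n <= \dim {:L})%N.
  by move=> /asboolP[s _ <-]; exact/dimvS/subvf.
case: (ex_maxnP P0 ubP) => _ /asboolP[s sX <-] smax.
exists <<s>>%VS => v; split => [vs|[t tX vt]]; first by exists s.
have sst : (<<s>> <= <<s ++ t>>)%VS by rewrite span_cat addvSl.
suff -> : <<s>>%VS = <<s ++ t>>%VS.
  by rewrite span_cat; apply: subvP vt; exact: addvSr.
apply/eqP; rewrite eqEdim sst; apply: smax; apply/asboolP; exists (s ++ t) => //.
by move=> x; rewrite mem_cat => /orP[/sX|/tX].
Qed.

(* Linear span of an arbitrary, possibly infinite, set of vectors;
   characterised by span_setP. *)
Definition span_set (X : set L) : {vspace L} := sval (cid (span_set_exists X)).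

Lemma span_setP (X : set L) v :
  v \in span_set X <->
  exists2 s : seq L, {in s, forall x, X x} & v \in <<s>>%VS.
Proof. exact: (svalP (cid (span_set_exists X))). Qed.

End Span.

Definition leibniz_identity (F : fieldType) (L : lmodType F) (br : L -> L -> L) :=
  forall a b c, br a (br b c) = br (br a b) c + br b (br a c).

(* Here br is the bracket of a finite-dimensional Leibniz algebra L, and a
   subalgebra S of L is treated as a Leibniz algebra in its own right. *)
Section Leibniz.
Variables (F : fieldType) (L : vectType F) (br : L -> L -> L).
Implicit Types S I J R : {vspace L}.

Definition Leib : {vspace L} := span_set (range (fun u => br u u)).

Definition bracketv I J : {vspace L} :=
  span_set [set w | exists u v, [/\ u \in I, v \in J & w = br u v]].

Definition subalgebra S := forall x y, x \in S -> y \in S -> br x y \in S.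

Definition ideal_of S I :=
  (I <= S)%VS /\
  forall x y, x \in S -> y \in I -> br x y \in I /\ br y x \in I.

Definition simple_leibniz :=
  bracketv fullv fullv <> Leib /\
  forall I, ideal_of fullv I <-> [\/ I = 0%VS, I = Leib | I = fullv].

Definition derived_series n I : {vspace L} := iter n (fun J => bracketv J J) I.

Definition solvable I := exists n, derived_series n I = 0%VS.

Definition is_radical S R :=
  [/\ ideal_of S R, solvable R &
      forall J, ideal_of S J -> solvable J -> (J <= R)%VS].

Definition semisimple_lie S :=
  [/\ subalgebra S, {in S, forall x, br x x = 0} & is_radical S 0%VS].

Definition levi_factor S :=
  semisimple_lie S /\
  exists R, [/\ is_radical fullv R, (S + R)%VS = fullv & directv (S + R)].

End Leibniz.

(* act s is the operator s_0 by which s, an element of the subalgebra S,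
   acts on V. *)
Section Modules.
Variables (F : fieldType) (L V : vectType F) (S : {vspace L}).
Variable act : L -> V -> V.
Implicit Types U W : {vspace V}.

Definition submodule W := forall s w, s \in S -> w \in W -> act s w \in W.

Definition trivial_submodule W := forall s w, s \in S -> w \in W -> act s w = 0.

Definition irreducible_submodule W :=
  [/\ W <> 0%VS, submodule W &
      forall U, (U <= W)%VS -> submodule U -> U = 0%VS \/ U = W].

End Modules.

Section Local.
Variables (F : fieldType) (A : comVectAlgType F).
Implicit Types I J M : {vspace A}.

(* Since A is unital, every ring ideal of A is a linear subspace. *)
Definition alg_ideal I := forall a x : A, x \in I -> a * x \in I.

Definition maximal_ideal M :=
  [/\ alg_ideal M, M <> fullv &
      forall J, alg_ideal J -> (M <= J)%VS -> J = M \/ J = fullv].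

Definition local_algebra := exists! M, maximal_ideal M.

End Local.

Record vertex_algebroid (F : fieldType) (A : comAlgType F) (B : lmodType F) :=
  VertexAlgebroid {
  va_act : {bilinear A -> B -> B};        (* a . v *)
  va_br : {bilinear B -> B -> B};         (* [u, v] = u_0 v *)
  va_anchor : {bilinear B -> A -> A};     (* pi(u)(a) = u_0 a *)
  va_pair : {bilinear B -> B -> A};       (* <u, v> = u_1 v *)
  va_del : {linear A -> B};
  va_act1 : forall v, va_act 1 v = v;
  va_leibniz : leibniz_identity va_br;
  va_anchorM : forall u a b,
      va_anchor u (a * b) = va_anchor u a * b + a * va_anchor u b;
  va_anchor_br : forall u v a, va_anchor (va_br u v) a =
      va_anchor u (va_anchor v a) - va_anchor v (va_anchor u a);
  va_pairC : forall u v, va_pair u v = va_pair v u;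
  va_anchor_del : forall a b, va_anchor (va_del a) b = 0;
  va_actA : forall a b v, va_act a (va_act b v) - va_act (a * b) v =
      va_act (va_anchor v a) (va_del b) + va_act (va_anchor v b) (va_del a);
  va_br_act : forall u a v, va_br u (va_act a v) =
      va_act (va_anchor u a) v + va_act a (va_br u v);
  va_br_sym : forall u v, va_br u v + va_br v u = va_del (va_pair u v);
  va_anchor_act : forall a v b, va_anchor (va_act a v) b = a * va_anchor v b;
  va_pair_act : forall a u v, va_pair (va_act a u) v =
      a * va_pair u v - va_anchor u (va_anchor v a);
  va_anchor_pair : forall v v1 v2, va_anchor v (va_pair v1 v2) =
      va_pair (va_br v v1) v2 + va_pair v1 (va_br v v2);
  va_delM : forall a b, va_del (a * b) = va_act a (va_del b) + va_act b (va_del a);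
  va_br_del : forall v a, va_br v (va_del a) = va_del (va_anchor v a);
  va_pair_del : forall v a, va_pair v (va_del a) = va_anchor v a
}.

(* Main.v *)
(* Every u in B is s + del b with s in span(e, f, h), and <del b, v> = v_0 b, so
   modulo C1 the pairings of u with e, f, h are e_0 b, f_0 b, h_0 b for a single
   b in A.  For u = a . e or u = a . f the same pairings are also given by the
   algebroid axioms, and comparing the two through the sl_2 commutation
   relations is a strong constraint on a: an sl_2-invariant a is a scalar, and
   a non-scalar a that is modulo C1 a highest weight vector of weight l forces
   k = l = 1.  Such an a comes from a highest weight vector of Leib(B) = del A,
   so neither complete reducibility nor the classification of sl_2-modules is
   used.  The pairings with e, f, h separate the points of B, which gives the
   remaining identities. *)

Require Import Defs.
From mathcomp Require Import all_boot all_order all_algebra.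
From mathcomp Require Import reals.
From mathcomp.real_closed Require Import complex.
From mathcomp Require Import ring boolp classical_sets.
Import GRing.Theory Num.Theory VectorInternalTheory.
Local Open Scope ring_scope.

Set Implicit Arguments.
Unset Strict Implicit.

(** * Eigenvectors and highest weight vectors in stable subspaces *)

Lemma lfun_eigenP (K : fieldType) (V : vectType K) (phi : 'End(V)) (a : K) :
  reflect (exists2 v, phi v = a *: v & v != 0) (root (char_poly (f2mx phi)) a).
Proof.
rewrite -eigenvalue_root_char; apply: (iffP eigenvalueP) => [[v vE v0]|[v vE v0]].
  exists (r2v v); last by rewrite (can2_eq r2vK v2rK) linear0.
  by rewrite unlock /= r2vK vE linearZ.
exists (v2r v); last by rewrite (can2_eq v2rK r2vK) linear0.
by rewrite -linearZ -vE unlock /= r2vK.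
Qed.

(** [phi] restricts to an endomorphism of [subvs_of U]; as this space has positive dimension, the
    characteristic polynomial is nonconstant and has a root. *)
Lemma stable_eigenvector (K : closedFieldType) (V : vectType K)
    (U : {vspace V}) (phi : 'End(V)) :
  U != 0%VS -> {in U, forall v, phi v \in U} ->
  exists a, exists v, [/\ v \in U, v != 0 & phi v = a *: v].
Proof.
move=> U0 Uphi.
pose psi : 'End(subvs_of U) :=
  (linfun (vsproj U) \o phi \o linfun (@vsval _ _ U))%VF.
have /closed_rootP[a /lfun_eigenP[u uE u0]] : size (char_poly (f2mx psi)) != 1%N.
  rewrite size_char_poly eqSS; rewrite -dimv_eq0 in U0; exact: U0.
exists a, (vsval u); split; first exact: subvsP.
  by rewrite -(inj_eq val_inj) /= in u0.
have := congr1 vsval uE; rewrite /psi !comp_lfunE !lfunE /= vsprojK //.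
exact/Uphi/subvsP.
Qed.

(* The iterates of E on an H-eigenvector have pairwise distinct eigenvalues, so
   one of them vanishes. *)
Lemma highest_weight_vector (K : numClosedFieldType) (V : vectType K)
    (U : {vspace V}) (E H : 'End(V)) :
  U != 0%VS -> {in U, forall v, E v \in U} -> {in U, forall v, H v \in U} ->
  {in U, forall v, H (E v) = 2 *: E v + E (H v)} ->
  exists a, exists v, [/\ v \in U, v != 0, E v = 0 & H v = a *: v].
Proof.
move=> U0 UE UH HE; have [a [v [vU v0 vE]]] := stable_eigenvector U0 UH.
pose w n := iter n E v.
have wU n : w n \in U by elim: n => //= n /UE.
have wH n : H (w n) = (a + (2 * n)%:R) *: w n.
  elim: n => [|n IH]; first by rewrite addr0.
  by rewrite /= HE // IH linearZ -scalerDl addrC mulnS natrD -addrA (addrC 2).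
have w0 : exists n, w n == 0.
  pose p := char_poly (f2mx H).
  have p0 : p != 0 by rewrite monic_neq0 ?char_poly_monic.
  (* These are [size p] distinct candidates, one more than the degree of [p], so some candidate is
     not a root, and the iterate with that index is zero. *)
  pose s := [seq a + (2 * n)%:R | n <- iota 0 (size p)].
  have us : uniq s.
    rewrite map_inj_uniq ?iota_uniq // => i j /addrI /eqP.
    by rewrite eqr_nat eqn_pmul2l // => /eqP.
  case: (boolP (all (root p) s)) => [rs|].
    by have := max_poly_roots p0 rs us; rewrite size_map size_iota ltnn.
  rewrite -has_predC has_map => /hasP[n _ /= nroot].
  exists n; apply: contraNT nroot => wn; apply/lfun_eigenP.
  by exists (w n).
case: (ex_minnP w0) => -[|m] /eqP wm min_m.
  by rewrite -[v]/(w 0%N) wm eqxx in v0.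
exists (a + (2 * m)%:R), (w m); split=> //.
by apply/negP => /min_m; rewrite ltnn.
Qed.

Lemma memv_span2P (K : fieldType) (V : vectType K) (u v w : V) :
  reflect (exists x y, w = x *: u + y *: v) (w \in <<[:: u; v]>>%VS).
Proof.
rewrite span_cons span_seq1; apply: (iffP memv_addP).
  by move=> [_ /vlineP[x ->] [_ /vlineP[y ->] ->]]; exists x, y.
by move=> [x [y ->]]; exists (x *: u); rewrite ?memvZ ?memv_line //;
  exists (y *: v); rewrite ?memvZ ?memv_line.
Qed.

(** * First consequences of the algebroid axioms *)

Section SimpleAlgebroid.

Variables (K : numClosedFieldType) (A : comVectAlgType K) (B : vectType K).
Variables (X : vertex_algebroid A B) (S : {vspace B}) (e f h : B) (k : K).
Local Notation br := (va_br X).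
Local Notation "u '⋅' a" := (va_anchor X u a) (at level 30, right associativity).
Local Notation "⟨ u , v ⟩" := (va_pair X u v).
Local Notation del := (va_del X).
Local Notation LeibB := (Leib br).

Let two_neq0 : 2 != 0 :> K. Proof. by rewrite pnatr_eq0. Qed.

Let scaleE c (x : A) : c *: x = in_alg A c * x.
Proof. by rewrite in_algE mulr_algl. Qed.

(* Scalars become elements of the commutative ring A, where ring applies. *)
Ltac modring := rewrite ?scaleE; ring.

(* Proves l' = r' from E : l = r when l' - r' is l - r or r - l. *)
Ltac lincomb E := apply: subr0_eq;
  match type of E with ?l = ?r =>
    first [ transitivity (l - r); [modring | by rewrite E subrr]
          | transitivity (r - l); [modring | by rewrite E subrr] ]
  end.

Lemma anchor1 u : u ⋅ (1 : A) = 0.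
Proof.
have := va_anchorM X u 1 1; rewrite !mulr1 mul1r => /eqP.
by rewrite -[X in X == _]addr0 (inj_eq (addrI _)) eq_sym => /eqP.
Qed.

Lemma anchor_scalar u (c : K) : u ⋅ (c *: 1 : A) = 0.
Proof. by rewrite linearZ /= anchor1 scaler0. Qed.

Lemma scalar_eq0 (c : K) : c%:A = 0 :> A -> c = 0.
Proof. by move/eqP; rewrite scaler_eq0 oner_eq0 orbF => /eqP. Qed.

Lemma del1 : del 1 = 0.
Proof.
have := va_delM X 1 1; rewrite mulr1 va_act1 => /eqP.
by rewrite -[X in X == _]addr0 (inj_eq (addrI _)) eq_sym => /eqP.
Qed.

(** By [va_br_sym] the two brackets of [del a] and [v] add up to [del (v ⋅ a)], which is already the
    bracket in the other order. *)
Lemma br_del_l a v : br (del a) v = 0.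
Proof.
have := va_br_sym X (del a) v.
by rewrite va_br_del va_pairC va_pair_del -[RHS]add0r => /addIr.
Qed.

(** * Ideals of B: the image of [del], the radical, and submodules of Leib(B) *)

Hypotheses (simpleB : simple_leibniz br) (Leib_neq0 : LeibB <> 0%VS).
Hypotheses (leviS : levi_factor br S) (basisS : basis_of S [:: e; f; h]).
Hypotheses (efh : br e f = h) (hee : br h e = 2 *: e) (hff : br h f = - (2 *: f)).
Hypotheses (pair_ef : ⟨e, f⟩ = k *: 1) (k_neq0 : k != 0).

Let eS : e \in S. Proof. by apply: (basis_mem basisS); rewrite inE eqxx. Qed.
Let fS : f \in S. Proof. by apply: (basis_mem basisS); rewrite !inE eqxx orbT. Qed.
Let hS : h \in S. Proof. by apply: (basis_mem basisS); rewrite !inE eqxx !orbT. Qed.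

Let h_neq0 : h != 0.
Proof. by apply: (basis_not0 basisS); rewrite !inE eqxx !orbT. Qed.

Let brS x : x \in S -> br x x = 0.
Proof. by move: x; case: leviS => -[]. Qed.

(** The image of [del] is an ideal, so simplicity leaves three cases. It is not 0, since every
    square [br u u] is [del] of half of [⟨u, u⟩]. It is not B, since left brackets by [del a] vanish
    while [br e f = h] does not. *)
Lemma limg_del : limg (linfun del) = LeibB.
Proof.
have delE a : linfun del a = del a by rewrite lfunE.
have : ideal_of br fullv (limg (linfun del)).
  split=> [|x _ _ /memv_imgP[a _ ->]]; first exact: subvf.
  rewrite delE br_del_l va_br_del -delE memv_img ?memvf //; split=> //.
  exact: mem0v.
move/simpleB.2 => [img0|//|imgT].
- case: Leib_neq0; apply/eqP; rewrite -subv0 -img0.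
  apply/subvP => w /span_setP[s sP ws]; apply: subvP w ws.
  apply/span_subvP => _ /sP[u _ <-].
  have -> : br u u = linfun del (2^-1 *: ⟨u, u⟩).
    by rewrite delE linearZ /= -va_br_sym -mulr2n -scaler_nat scalerK.
  by rewrite memv_img ?memvf.
- have /memv_imgP[a _ eE] : e \in limg (linfun del) by rewrite imgT memvf.
  have /eqP : h = 0 by rewrite -efh eE delE br_del_l.
  by rewrite (negPf h_neq0).
Qed.

Lemma LeibP w : w \in LeibB -> exists a, w = del a.
Proof. by rewrite -limg_del => /memv_imgP[a _ ->]; exists a; rewrite lfunE. Qed.

Lemma del_Leib a : del a \in LeibB.
Proof. by rewrite -limg_del -[del a](lfunE del) memv_img ?memvf. Qed.

(** The radical is an ideal. Were it 0, B would equal S, where all squares vanish, so Leib(B) would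
    be 0; were it B, the sum with S would not be direct. *)
Lemma levi_decomp : (S + LeibB)%VS = fullv.
Proof.
case: leviS => _ [R [[idR _ _] SR dSR]].
case/simpleB.2: idR => RE; rewrite RE in SR dSR => //.
- case: Leib_neq0; apply/eqP; rewrite -subv0.
  apply/subvP => w /span_setP[s sP ws]; apply: subvP w ws.
  apply/span_subvP => _ /sP[u _ <-].
  by rewrite brS ?mem0v // -[S]addv0 SR memvf.
- have /directv_addP SI := dSR.
  have : e \in (S :&: fullv)%VS by rewrite memv_cap eS memvf.
  have e0 : e != 0 by apply: (basis_not0 basisS); rewrite inE eqxx.
  by rewrite SI memv0 (negPf e0).
Qed.

Lemma sl2_del_decomp w : exists x y z b, w = x *: e + y *: f + z *: h + del b.
Proof.
have : w \in (S + LeibB)%VS by rewrite levi_decomp memvf.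
case/memv_addP => s; rewrite -(span_basis basisS) span_cons.
case/memv_addP => _ /vlineP[x ->] [_ /memv_span2P[y [z ->]] ->] [_ /LeibP[b ->] ->].
by exists x, y, z, b; rewrite !addrA.
Qed.

(** An S-submodule of Leib(B) is a two-sided ideal of B: its elements are of the form [del a], so
    they bracket to zero from the left, and the [del b] part of any element of B does too. *)
Lemma Leib_irreducible : irreducible_submodule S br LeibB.
Proof.
split=> // [s _ _ /LeibP[a ->]|U UL stU]; first by rewrite va_br_del del_Leib.
suff /simpleB.2 : ideal_of br fullv U.
  case=> [|| UT]; [by left | by right | right].
  by apply/eqP; rewrite eqEsubv UL UT subvf.
split=> [|u w _ wU]; first exact: subvf.
have /LeibP[a wE] := subvP UL _ wU.
rewrite {2}wE br_del_l mem0v; split=> //.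
have [x [y [z [b ->]]]] := sl2_del_decomp u.
rewrite linearDl /= br_del_l addr0 stU //.
by rewrite !(memvD, memvZ).
Qed.

(** * The sl_2 relations on A and the pairings with e, f, h *)

Let ee0 := brS eS.
Let ff0 := brS fS.
Let decomp := sl2_del_decomp.

Lemma anchor_ef a : e ⋅ f ⋅ a = h ⋅ a + f ⋅ e ⋅ a.
Proof. by rewrite -efh va_anchor_br subrK. Qed.

Lemma anchor_he a : h ⋅ e ⋅ a = 2 *: (e ⋅ a) + e ⋅ h ⋅ a.
Proof. by rewrite -linearZl_LR -hee va_anchor_br subrK. Qed.

Lemma anchor_hf a : h ⋅ f ⋅ a = f ⋅ h ⋅ a - 2 *: (f ⋅ a).
Proof. rewrite -linearZl_LR -linearNl /= -hff va_anchor_br; ring. Qed.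

(** Each value comes from [va_anchor_pair] on a triple whose left side is the derivative of a
    scalar. The reversed brackets come from [va_br_sym], where [del] kills the scalar pairings. *)
Lemma sl2_pairings :
  [/\ ⟨e, e⟩ = 0, ⟨f, f⟩ = 0, ⟨e, h⟩ = 0, ⟨f, h⟩ = 0 & ⟨h, h⟩ = (2 * k) *: 1].
Proof.
have brC u v : br v u = del ⟨u, v⟩ - br u v.
  by rewrite -va_br_sym addrAC subrr add0r.
have eh0 : ⟨e, h⟩ = 0.
  have := va_anchor_pair X e e f.
  by rewrite ee0 efh pair_ef anchor_scalar linear0l add0r.
have fe : br f e = - h by rewrite brC pair_ef linearZ /= del1 scaler0 efh sub0r.
have fh0 : ⟨f, h⟩ = 0.
  have := va_anchor_pair X f e f.
  rewrite ff0 fe pair_ef anchor_scalar linear0r linearNl /= addr0.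
  by rewrite va_pairC => /esym/eqP; rewrite oppr_eq0 => /eqP.
have eh : br e h = - (2 *: e).
  by rewrite brC va_pairC eh0 linear0 sub0r hee.
have fh : br f h = 2 *: f.
  by rewrite brC va_pairC fh0 linear0 sub0r hff opprK.
split=> //.
- have := va_anchor_pair X e e h.
  rewrite ee0 eh eh0 linear0 linear0l add0r linearNr linearZr_LR => /esym/eqP.
  by rewrite oppr_eq0 scaler_eq0 (negPf two_neq0) => /eqP.
- have := va_anchor_pair X f f h.
  rewrite ff0 fh fh0 linear0 linear0l add0r linearZr_LR => /esym/eqP.
  by rewrite scaler_eq0 (negPf two_neq0) => /eqP.
- have := va_anchor_pair X e h f.
  rewrite eh efh va_pairC fh0 linear0 linearNl linearZl_LR pair_ef => /esym/eqP.
  by rewrite addrC subr_eq0 scalerA => /eqP.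
Qed.

Lemma pairing_coord x y z b : let w := x *: e + y *: f + z *: h + del b in
  [/\ ⟨w, e⟩ = e ⋅ b + (y * k)%:A, ⟨w, f⟩ = f ⋅ b + (x * k)%:A &
      ⟨w, h⟩ = h ⋅ b + (z * (2 * k))%:A].
Proof.
have [ee ff eh fh hh] := sl2_pairings.
have delE u : ⟨del b, u⟩ = u ⋅ b by rewrite va_pairC va_pair_del.
by split; rewrite !linearDl !linearZl_LR /= delE ?ee ?ff ?eh ?fh ?hh ?pair_ef;
   rewrite 1?(va_pairC _ f e) 1?(va_pairC _ h e) 1?(va_pairC _ h f);
   rewrite ?pair_ef ?eh ?fh !scaler0 ?scalerA ?addr0 ?add0r addrC.
Qed.

Lemma pairing_decomp w : exists b, exists x y z : K,
  [/\ ⟨w, e⟩ = e ⋅ b + x%:A, ⟨w, f⟩ = f ⋅ b + y%:A & ⟨w, h⟩ = h ⋅ b + z%:A].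
Proof.
have [x [y [z [b ->]]]] := decomp w.
by exists b, (y * k), (x * k), (z * (2 * k)); exact: pairing_coord.
Qed.

(** * Constraints on elements of A from their action on e and f *)

Lemma act_e_decomp a : exists b, exists x y z : K,
  [/\ e ⋅ b = x%:A - e ⋅ e ⋅ a, f ⋅ b = k *: a - e ⋅ f ⋅ a + y%:A &
      h ⋅ b = z%:A - e ⋅ h ⋅ a].
Proof.
have [ee _ eh _ _] := sl2_pairings.
have [b [x [y [z]]]] := pairing_decomp (va_act X a e).
rewrite !va_pair_act ee eh pair_ef => -[].
move=> /esym/(canRL (addrK _)) eb /esym/(canRL (addrK _)) fb.
move=> /esym/(canRL (addrK _)) hb.
by exists b, (- x), (- y), (- z); rewrite eb fb hb; split; modring.
Qed.

Lemma act_f_decomp a : exists b, exists x y z : K,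
  [/\ e ⋅ b = k *: a - f ⋅ e ⋅ a + x%:A, f ⋅ b = y%:A - f ⋅ f ⋅ a &
      h ⋅ b = z%:A - f ⋅ h ⋅ a].
Proof.
have [_ ff _ fh _] := sl2_pairings.
have [b [x [y [z]]]] := pairing_decomp (va_act X a f).
rewrite !va_pair_act ff fh [va_pair X f e]va_pairC pair_ef => -[].
move=> /esym/(canRL (addrK _)) eb /esym/(canRL (addrK _)) fb.
move=> /esym/(canRL (addrK _)) hb.
by exists b, (- x), (- y), (- z); rewrite eb fb hb; split; modring.
Qed.

(** For invariant [a], [f ⋅ b] is [k *: a] plus a scalar and [h ⋅ b] is a scalar, so both are killed
    by the sl_2 action. The relation [h, f] = -2f on [b] then leaves [f ⋅ b = 0]. *)
Lemma invariant_scalar a :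
  e ⋅ a = 0 -> f ⋅ a = 0 -> h ⋅ a = 0 -> exists c, a = c%:A.
Proof.
move=> ea fa ha; have [b [x [y [z []]]]] := act_e_decomp a.
rewrite ea fa ha !linear0r !subr0 => _ fb hb.
have := anchor_hf b; rewrite hb {1}fb linearDr /= linearZr_LR /= ha !anchor_scalar.
rewrite scaler0 add0r sub0r => /esym/eqP; rewrite oppr_eq0 scaler_eq0.
rewrite (negPf two_neq0) fb addr_eq0 -scaleNr => /eqP ka.
by exists (k^-1 * - y); rewrite -scalerA -ka scalerK.
Qed.

(* Compares h_0 b with [e_0, f_0] b and [h_0, e_0] b with 2 e_0 b for the b of
   act_f_decomp a. *)
Lemma maximal_weight (a : A) (l c1 c2 : K) :
  a \notin <[1]>%VS -> e ⋅ a = c1%:A -> h ⋅ a = l *: a + c2%:A -> k = 1 /\ l = 1.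
Proof.
move=> aN ea ha; have [b [x [y [z [eb fb hb]]]]] := act_f_decomp a.
have scalE (p q : K) : p *: a = q%:A -> p = 0.
  move=> pa; apply: contraNeq aN => p0; apply/vlineP; exists (p^-1 * q).
  by rewrite -scalerA -pa scalerK.
have u1 u (c : K) := anchor_scalar u c.
have fea : f ⋅ e ⋅ a = 0 by rewrite ea u1.
have fha : f ⋅ h ⋅ a = l *: (f ⋅ a).
  by rewrite ha linearDr linearZr_LR /= u1 addr0.
have efa : e ⋅ f ⋅ a = l *: a + c2%:A by rewrite anchor_ef fea ha addr0.
have hfa : h ⋅ f ⋅ a = (l - 2) *: (f ⋅ a) by rewrite anchor_hf fha scalerBl.
have effa : e ⋅ f ⋅ f ⋅ a = (2 * l - 2) *: (f ⋅ a).
  rewrite anchor_ef hfa efa linearDr linearZr_LR /= u1; modring.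
rewrite fea subr0 in eb; rewrite fha in hb.
have fa_eq : (2 - l - k) *: (f ⋅ a) = z%:A.
  have := anchor_ef b; rewrite fb hb eb linearBr u1 linearDr u1 linearZr_LR effa => E.
  by lincomb E.
(* Otherwise [f ⋅ a] is a scalar. Then [e ⋅ f ⋅ a = 0] forces [l = 0], and e, f, h all kill [a],
   which is thus a scalar, contrary to [aN]. *)
have k_eq : k = 2 - l.
  apply/eqP; rewrite eq_sym -subr_eq0; apply/negPn/negP => n0.
  have [c fa] : exists c, f ⋅ a = c%:A.
    by exists ((2 - l - k)^-1 * z); rewrite -scalerA -fa_eq scalerK.
  have l0 : l = 0.
    apply: (scalE _ (- c2)); move/esym/eqP: efa; rewrite fa u1 addr_eq0 => /eqP ->.
    by rewrite scaleNr.
  have fa0 : f ⋅ a = 0.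
    apply/eqP; move/eqP: hfa; rewrite fa u1 l0 sub0r eq_sym scaler_eq0.
    by rewrite oppr_eq0 (negPf two_neq0).
  have ha0 : h ⋅ a = 0 by move/eqP: efa; rewrite fa0 linear0r ha => /eqP <-.
  have ea0 : e ⋅ a = 0.
    apply/eqP; have /eqP := anchor_he a; rewrite ha0 {1}ea u1 linear0r addr0.
    by rewrite eq_sym scaler_eq0 (negPf two_neq0).
  have [d ad] := invariant_scalar ea0 fa0 ha0.
  by move: aN; rewrite ad memvZ // memv_line.
have : (k * l - 2 * k + l * l) *: a = (2 * x - k * c2 - l * c2)%:A.
  have := anchor_he b; rewrite hb eb linearBr linearDr !u1 !linearZr_LR /= efa ha => E.
  by lincomb E.
move/scalE; rewrite k_eq => E.
(* With [k = 2 - l] the quadratic terms cancel and the coefficient of [a] becomes 4(l - 1). *)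
have l1 : l = 1.
  apply: subr0_eq; apply: (mulfI (_ : 4 != 0)); first by rewrite pnatr_eq0.
  by rewrite mulr0 -E; ring.
by rewrite l1; split => //; ring.
Qed.

(** If x e + y f + z h + del b pairs to zero with e, f, h, then these three send [b] to scalars,
    which they kill. The commutation relations then make those scalars zero, so x = y = z = 0 and
    [b] is invariant, hence in the kernel of [del]. *)
Lemma pairing_inj w w' :
  ⟨w, e⟩ = ⟨w', e⟩ -> ⟨w, f⟩ = ⟨w', f⟩ -> ⟨w, h⟩ = ⟨w', h⟩ -> w = w'.
Proof.
move=> we wf wh; apply: subr0_eq.
have: [/\ ⟨w - w', e⟩ = 0, ⟨w - w', f⟩ = 0 & ⟨w - w', h⟩ = 0].
  by rewrite !linearBl /= we wf wh !subrr.
have [x [y [z [b ->]]]] := decomp (w - w').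
have [-> -> ->] := pairing_coord x y z b => -[/eqP + /eqP + /eqP].
rewrite !addr_eq0 -!scaleNr => /eqP eb /eqP fb /eqP hb.
have := anchor_he b; rewrite eb hb !anchor_scalar addr0 scalerA => /esym/scalar_eq0/eqP.
rewrite mulf_eq0 (negPf two_neq0) oppr_eq0 mulf_eq0 (negPf k_neq0) orbF => /eqP y0.
have := anchor_hf b; rewrite fb hb !anchor_scalar sub0r scalerA -scaleNr.
move=> /esym/scalar_eq0/eqP.
rewrite oppr_eq0 mulf_eq0 (negPf two_neq0) oppr_eq0 mulf_eq0 (negPf k_neq0) orbF.
move=> /eqP x0.
have := anchor_ef b; rewrite eb fb hb !anchor_scalar addr0 => /esym/scalar_eq0/eqP.
rewrite oppr_eq0 !mulf_eq0 (negPf two_neq0) (negPf k_neq0) !orbF => /eqP z0.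
have [||| c ->] := @invariant_scalar b.
- by rewrite eb y0 mul0r oppr0 scale0r.
- by rewrite fb x0 mul0r oppr0 scale0r.
- by rewrite hb z0 mul0r oppr0 scale0r.
by rewrite x0 y0 z0 !scale0r linearZ /= del1 scaler0 !addr0.
Qed.

Lemma del_eq0 a : del a = 0 -> exists c, a = c%:A.
Proof.
by move=> a0; apply: invariant_scalar; rewrite -va_pair_del a0 linear0r.
Qed.

(** A highest weight vector of Leib(B) has the form [del a], and its equations lift to A only modulo
    the kernel of [del], that is, modulo scalars; this accounts for [c1] and [c2] in
    [maximal_weight]. *)
Lemma weight1_vector : exists a0, [/\ a0 != 0, e ⋅ a0 = 0 & h ⋅ a0 = a0].
Proof.
have stL u : {in LeibB, forall v, linfun (br u) v \in LeibB}.
  by move=> _ /LeibP[a ->]; rewrite lfunE /= va_br_del del_Leib.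
have Leib0 : LeibB != 0%VS by apply/eqP.
have HE : {in LeibB, forall v, linfun (br h) (linfun (br e) v) =
    2 *: linfun (br e) v + linfun (br e) (linfun (br h) v)}.
  by move=> v _; rewrite !lfunE /= va_leibniz hee linearZl_LR.
have [l [v [/LeibP[a ->] a0]]] := highest_weight_vector Leib0 (stL e) (stL h) HE.
rewrite !lfunE /= !va_br_del => /del_eq0[c1 ea] /eqP.
rewrite -subr_eq0 -linearZ -linearB /= => /eqP/del_eq0[c2 /(canRL (subrK _)) ha].
have aN : a \notin <[1]>%VS.
  by apply: contra_neqN a0 => /vlineP[c ->]; rewrite linearZ /= del1 scaler0.
rewrite addrC in ha.
have [_ l1] := maximal_weight aN ea ha.
(* The relation [h, e] = 2e on [a] gives 3 c1 = 0. *)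
have c10 : c1 = 0.
  have := anchor_he a; rewrite ha ea linearDr !anchor_scalar linearZr_LR /= ea l1.
  rewrite scale1r addr0 scalerA -scalerDl => /esym/scalar_eq0/eqP.
  by rewrite -[X in _ + X]mul1r -mulrDl natr1 mulf_eq0 pnatr_eq0 => /eqP.
(* As [l = 1], [h ⋅ a] is [a] plus [c2], and this shift by a scalar makes it an exact
   eigenvector. *)
exists (a + c2 *: 1); rewrite !linearDr /= !anchor_scalar !addr0.
rewrite ea c10 scale0r ha l1 scale1r; split=> //; apply: contraNneq aN => /eqP.
rewrite addr_eq0 => /eqP ->.
by rewrite memvN memvZ ?memv_line.
Qed.

(** * The two-dimensional module generated by a vector of weight 1 *)

Section HighestWeightVector.

Variable a0 : A.
Hypotheses (a0_neq0 : a0 != 0) (ea0 : e ⋅ a0 = 0) (ha0 : h ⋅ a0 = a0).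
Local Notation a1 := (f ⋅ a0).

Lemma pairing_const : k = 1.
Proof.
have a0N : a0 \notin <[1]>%VS.
  apply/vlineP => -[c a0E]; case/eqP: a0_neq0.
  by rewrite -ha0 a0E anchor_scalar.
have [] // := @maximal_weight a0 1 0 0 a0N.
- by rewrite ea0 scale0r.
- by rewrite ha0 scale1r scale0r addr0.
Qed.

Lemma ea1 : e ⋅ a1 = a0.
Proof. by rewrite anchor_ef ea0 linear0r addr0. Qed.

Lemma ha1 : h ⋅ a1 = - a1.
Proof. rewrite anchor_hf ha0; modring. Qed.

(** The relation [h, f] = -2f on the [b] of [act_f_decomp a0] shows that [f ⋅ a1] is a scalar. It
    also has weight -3, whereas h kills scalars. *)
Lemma fa1 : f ⋅ a1 = 0.
Proof.
have [b [x [y [z [_ fb hb]]]]] := act_f_decomp a0.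
have hffa : h ⋅ f ⋅ a1 = - 3 *: (f ⋅ a1) by rewrite anchor_hf ha1 linearNr; modring.
have E : 2 *: (f ⋅ a1) = (- 2 * y)%:A.
  have := anchor_hf b; rewrite fb hb !linearBr ha0 !anchor_scalar hffa => E.
  by lincomb E.
have ffaE : f ⋅ a1 = (2^-1 * (- 2 * y))%:A by rewrite -scalerA -E scalerK.
move/eqP: hffa; rewrite {1}ffaE anchor_scalar eq_sym scaler_eq0 oppr_eq0.
by rewrite pnatr_eq0 => /eqP.
Qed.

Lemma del_pairings :
  [/\ ⟨del a0, e⟩ = 0, ⟨del a0, f⟩ = a1, ⟨del a0, h⟩ = a0 &
    [/\ ⟨del a1, e⟩ = a0, ⟨del a1, f⟩ = 0 & ⟨del a1, h⟩ = - a1]].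
Proof.
by split; [..|split]; rewrite va_pairC va_pair_del ?ea0 ?ha0 ?ea1 ?ha1 ?fa1.
Qed.

(** Both sides of each identity have the same pairings with e, f, h, so [pairing_inj] applies. *)
Lemma sl2_actions :
  [/\ va_act X a0 e = 0, va_act X a0 f = del a1 & va_act X a0 h = del a0] /\
  [/\ va_act X a1 e = del a0, va_act X a1 f = 0 & va_act X a1 h = - del a1].
Proof.
have [ee ff eh fh hh] := sl2_pairings.
have [d0e d0f d0h [d1e d1f d1h]] := del_pairings.
have fe : ⟨f, e⟩ = 1 by rewrite va_pairC pair_ef pairing_const scale1r.
have ef : ⟨e, f⟩ = 1 by rewrite va_pairC.
have he : ⟨h, e⟩ = 0 by rewrite va_pairC.
have hf : ⟨h, f⟩ = 0 by rewrite va_pairC.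
rewrite pairing_const mulr1 in hh.
by do 2!split; apply: pairing_inj;
   rewrite ?linear0l ?linearNl /= ?(d0e, d0f, d0h, d1e, d1f, d1h) va_pair_act
     ?(ee, ff, eh, fh, hh, fe, ef, he, hf) ?ea0 ?ha0 ?ea1 ?ha1 ?fa1;
   rewrite ?linearNr /= ?linear0r ?ea0 ?ha0 ?ea1 ?ha1 ?fa1; modring.
Qed.

(** Since [a0 = e ⋅ a1] and [a1 = f ⋅ a0], [va_anchor_act] turns each product into the anchor of
    some [va_act X a v] with [v] equal to e or f. By [sl2_actions] that element is zero or in the
    image of [del], so its anchor vanishes. *)
Lemma weight_products : [/\ a0 * a0 = 0, a0 * a1 = 0, a1 * a0 = 0 & a1 * a1 = 0].
Proof.
have [[a0e a0f _] [a1e a1f _]] := sl2_actions.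
have prodE a v b w : va_act X a v = w -> w ⋅ b = 0 -> a * (v ⋅ b) = 0.
  by move=> <-; rewrite va_anchor_act.
have zeroA (b : A) : (0 : B) ⋅ b = 0 by rewrite linear0l.
have delA c (b : A) : del c ⋅ b = 0 by rewrite va_anchor_del.
split.
- by rewrite -[X in _ * X]ea1; exact: prodE a0e (zeroA _).
- exact: prodE a0f (delA _ _).
- by rewrite -[X in _ * X]ea1; exact: prodE a1e (delA _ _).
- exact: prodE a1f (zeroA _).
Qed.

Lemma weight_del_actions :
  [/\ va_act X a0 (del a0) = 0, va_act X a0 (del a1) = 0,
      va_act X a1 (del a0) = 0 & va_act X a1 (del a1) = 0].
Proof.
have [a00 a01 a10 a11] := weight_products.
have [d0e d0f d0h [d1e d1f d1h]] := del_pairings.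
by split; apply: pairing_inj; rewrite va_pair_act va_anchor_del linear0l subr0
  ?(d0e, d0f, d0h, d1e, d1f, d1h) ?mulrN ?(mulr0, a00, a01, a10, a11) ?oppr0.
Qed.

Lemma weight_free : free [:: 1; a0; a1].
Proof.
have [a00 a01 _ _] := weight_products.
rewrite !free_cons nil_free span_nil memv0 andbT; apply/and3P; split.
(* Multiplying a relation 1 = x a0 + y a1 by [a0] gives [a0 = 0]. *)
- apply/memv_span2P => -[x [y E]]; case/eqP: a0_neq0.
  by rewrite -[a0]mulr1 E mulrDr -!scalerAr a00 a01 !scaler0 addr0.
- rewrite span_seq1; apply/vlineP => -[x E]; case/eqP: (a0_neq0).
  have := ea0; rewrite E linearZr_LR /= ea1 => /eqP.
  by rewrite scaler_eq0 (negPf a0_neq0) orbF => /eqP ->; rewrite scale0r.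
- by apply: contra_neq a0_neq0 => a1_0; rewrite -ea1 a1_0 linear0r.
Qed.

Lemma weight_del_free : free [:: del a0; del a1].
Proof.
have [d0e d0f d0h [d1e d1f d1h]] := del_pairings.
have d1_neq0 : del a1 != 0.
  by apply: contra_neq a0_neq0 => d1; rewrite -d1e d1 linear0l.
rewrite !free_cons nil_free span_nil memv0 d1_neq0 !andbT span_seq1.
apply/vlineP => -[x E]; case/eqP: (a0_neq0).
have := d0e; rewrite E linearZl_LR /= d1e => /eqP.
rewrite scaler_eq0 (negPf a0_neq0) orbF => /eqP x0.
by rewrite -d0h E x0 scale0r linear0l.
Qed.

Lemma weight_span_stable u w : w \in <<[:: a0; a1]>>%VS -> u ⋅ w \in <<[:: a0; a1]>>%VS.
Proof.
move=> /memv_span2P[p [q ->]]; have [x [y [z [b ->]]]] := decomp u.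
rewrite linearDr !linearZr_LR /= !linearDl !linearZl_LR /= !va_anchor_del.
rewrite ea0 ha0 ea1 ha1 fa1.
have a0S : a0 \in <<[:: a0; a1]>>%VS by rewrite memv_span ?mem_head.
have a1S : a1 \in <<[:: a0; a1]>>%VS by rewrite memv_span ?inE ?eqxx ?orbT.
by rewrite !(memvD, memvZ, mem0v, memvN).
Qed.

Lemma weight_span_simple (U : {vspace A}) : (U <= <<[:: a0; a1]>>)%VS ->
  {in U, forall w, e ⋅ w \in U /\ f ⋅ w \in U} -> U = 0%VS \/ U = <<[:: a0; a1]>>%VS.
Proof.
move=> UW stU; case: (eqVneq U 0%VS) => [|U0]; [by left | right].
suff a0U : a0 \in U.
  apply/eqP; rewrite eqEsubv UW; apply/span_subvP => w; rewrite !inE.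
  by case/pred2P => ->; [|case: (stU _ a0U)].
have vU := memv_pick U; have v0 : vpick U != 0 by rewrite vpick0.
have /memv_span2P[p [q E]] := subvP UW _ vU.
(* A nonzero vector p a0 + q a1 of [U] is a multiple of [a0] if q = 0; otherwise e sends it to q
   a0. *)
case: (eqVneq q 0) => [q0|q0].
  have p0 : p != 0 by apply: contra_neq v0 => p0; rewrite E p0 q0 !scale0r addr0.
  by move: vU; rewrite E q0 scale0r addr0 rpredZeq (negPf p0).
have [+ _] := stU _ vU; rewrite E linearDr !linearZr_LR /= ea0 ea1.
by rewrite scaler0 add0r rpredZeq (negPf q0).
Qed.

(** * Bases of Leib(B) and A, and the maximal ideal *)

Let del_comb p q : del (p *: a0 + q *: a1) = p *: del a0 + q *: del a1.
Proof. by rewrite linearD !linearZ. Qed.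

(** The span of the two vectors is a nonzero ideal. It is not B, since [e] would then lie in the
    image of [del] and [br e f] would vanish. *)
Lemma Leib_basis : basis_of LeibB [:: del a0; del a1].
Proof.
have df := weight_del_free; rewrite /basis_of df andbT; apply/eqP.
have delW w : w \in <<[:: a0; a1]>>%VS -> del w \in <<[:: del a0; del a1]>>%VS.
  move=> /memv_span2P[p [q ->]]; apply/memv_span2P; exists p, q; exact: del_comb.
have : ideal_of br fullv <<[:: del a0; del a1]>>%VS.
  split=> [|u _ _ /memv_span2P[p [q ->]]]; first exact: subvf.
  rewrite -del_comb br_del_l mem0v va_br_del; split=> //; apply/delW/weight_span_stable.
  by apply/memv_span2P; exists p, q.
move/simpleB.2 => [W0|//|WT].
- have := free_not0 df (mem_head _ _); rewrite -memv0 -W0.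
  by rewrite memv_span ?mem_head.
- have /memv_span2P[p [q]] : e \in <<[:: del a0; del a1]>>%VS by rewrite WT memvf.
  rewrite -del_comb => eE.
  by case/eqP: h_neq0; rewrite -efh eE br_del_l.
Qed.

(** Subtracting from [a] the combination of [a0] and [a1] with the same image under [del] leaves a
    scalar, by [del_eq0]. *)
Lemma algebra_basis : basis_of fullv [:: 1; a0; a1].
Proof.
rewrite /basis_of weight_free andbT; apply/eqP/vspaceP => a; rewrite memvf.
have := del_Leib a; rewrite -(span_basis Leib_basis) => /memv_span2P[p [q /eqP]].
rewrite -del_comb -subr_eq0 -linearB => /eqP/del_eq0[c /(canRL (subrK _)) ->].
rewrite span_cons memv_add ?memvZ ?memv_line //.
by apply/memv_span2P; exists p, q.
Qed.

(** A is the sum of the scalars and a square-zero ideal [W], so every element outside [W] is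
    invertible and [W] contains all proper ideals. *)
Lemma weight_maximal_ideal M : maximal_ideal M <-> M = <<[:: a0; a1]>>%VS.
Proof.
have [a00 a01 a10 a11] := weight_products.
set W := <<_>>%VS.
have decA a : exists c w, w \in W /\ a = c *: 1 + w.
  have : a \in fullv by rewrite memvf.
  rewrite -(span_basis algebra_basis) span_cons.
  case/memv_addP => _ /vlineP[c ->] [w wW ->].
  by exists c, w.
have WW w w' : w \in W -> w' \in W -> w * w' = 0.
  move=> /memv_span2P[p [q ->]] /memv_span2P[r [s ->]].
  by rewrite mulrDl !mulrDr -!scalerAl -!scalerAr a00 a01 a10 a11 !scaler0 !addr0.
have idW : alg_ideal W.
  move=> a w wW; have [c [w' [w'W ->]]] := decA a.
  by rewrite mulrDl (WW w') // addr0 -scalerAl mul1r memvZ.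
have id1 J : alg_ideal J -> 1 \in J -> J = fullv.
  by move=> idJ J1; apply/vspaceP => a; rewrite memvf -[a]mulr1 idJ.
have subW J : alg_ideal J -> J <> fullv -> (J <= W)%VS.
  move=> idJ JT; apply/subvP => x xJ; have [c [w [wW xE]]] := decA x.
  case: (eqVneq c 0) => [c0|c0]; first by rewrite xE c0 scale0r add0r.
  case: JT; apply: id1 => //.
  (* As w * w = 0, multiplying c + w by c - w gives the nonzero scalar c^2. *)
  have : (c *: 1 - w) * x \in J by exact: idJ.
  rewrite xE -subr_sqr exprZn expr1n (expr2 w) (WW w) // subr0.
  by rewrite rpredZeq expf_eq0 (negPf c0).
have WT : W <> fullv.
  move=> WT; have := basis_free algebra_basis.
  by rewrite free_cons -/W WT memvf.
split=> [[idM MT maxM]|->].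
  by case: (maxM W idW (subW _ idM MT)).
split=> // J idJ WJ; case: (pselect (J = fullv)) => [|JT]; [by right|left].
by apply/eqP; rewrite eqEsubv WJ subW.
Qed.

End HighestWeightVector.

End SimpleAlgebroid.

(** * Simple vertex algebroids over the complex numbers [R[i]] *)

Unset Implicit Arguments.
Set Strict Implicit.

Theorem theorem36 (R : realType) (A : comVectAlgType R[i]) (B : vectType R[i])
  (X : vertex_algebroid A B) (S : {vspace B}) (e f h : B) (k : R[i])
  (hA : ~ (forall (u : B) (a : A), va_anchor X u a = 0))
  (hB : simple_leibniz (va_br X))
  (hLeib : Leib (va_br X) <> 0%VS)
  (hS : levi_factor (va_br X) S)
  (hefh : basis_of S [:: e; f; h])
  (hef : va_br X e f = h)
  (hhe : va_br X h e = 2 *: e)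
  (hhf : va_br X h f = - (2 *: f))
  (hk : va_pair X e f = k *: 1)
  (hk0 : k *: (1 : A) != 0) :
  [/\ (* (i) *)
      [/\ [/\ va_pair X e e = 0, va_pair X f f = 0,
              va_pair X e h = 0 & va_pair X f h = 0],
          k = 1 & va_pair X h h = 2 *: 1],
      (* (ii) *)
      lker (linfun (va_del X)) = <[1]>%VS,
      (* (iii) *)
      [/\ irreducible_submodule S (va_br X) (Leib (va_br X)),
          \dim (Leib (va_br X)) = 2%N &
          exists T W : {vspace A},
            [/\ trivial_submodule S (va_anchor X) T,
                irreducible_submodule S (va_anchor X) W, \dim W = 2%N,
                (T + W)%VS = fullv & directv (T + W)]] &
      (* (iv) *)
      local_algebra A /\
      forall (W : {vspace A}) (a0 : A),
        irreducible_submodule S (va_anchor X) W -> \dim W = 2%N ->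
        a0 \in W -> a0 <> 0 ->
        va_anchor X e a0 = 0 -> va_anchor X h a0 = a0 ->
        let a1 := va_anchor X f a0 in
        [/\ [/\ basis_of W [:: a0; a1], basis_of fullv [:: 1; a0; a1] &
                basis_of (Leib (va_br X)) [:: va_del X a0; va_del X a1]],
            [/\ va_pair X (va_del X a0) e = 0,
                va_pair X (va_del X a0) f = a1,
                va_pair X (va_del X a0) h = a0 &
                [/\ va_pair X (va_del X a1) e = a0,
                    va_pair X (va_del X a1) f = 0 &
                    va_pair X (va_del X a1) h = - a1]],
            [/\ va_act X a0 e = 0,
                va_act X a0 f = va_del X a1,
                va_act X a0 h = va_del X a0,
                va_act X a0 (va_del X a0) = 0 &
                va_act X a0 (va_del X a1) = 0],
            [/\ va_act X a1 e = va_del X a0,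
                va_act X a1 f = 0,
                va_act X a1 h = - va_del X a1,
                va_act X a1 (va_del X a0) = 0 &
                va_act X a1 (va_del X a1) = 0] &
            [/\ a0 * a0 = 0, a0 * a1 = 0, a1 * a0 = 0 & a1 * a1 = 0]]].
Proof.
have k0 : k != 0 by move: hk0; rewrite scaler_eq0 oner_eq0 orbF.
have [eS fS] : e \in S /\ f \in S.
  by split; apply: (basis_mem hefh); rewrite !inE eqxx ?orbT.
(* This vector serves (i) to (iii) and locality; the relations of (iv) are obtained from the same
   lemmas with the given [a0] in its place. *)
have [b0 [b0N eb0 hb0]] := weight1_vector hB hLeib hS hefh hef hhe hhf hk k0.
have k1 := pairing_const hB hLeib hS hefh hef hhe hhf hk k0 b0N eb0 hb0.
split.
- have [? ? ? ? hh] := sl2_pairings hS hefh hef hhe hhf hk.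
  by rewrite k1 mulr1 in hh.
- apply/vspaceP => a; rewrite memv_ker lfunE /=; apply/eqP/vlineP.
    exact: (del_eq0 hB hLeib hS hefh hef hhe hhf hk k0).
  by move=> [c ->]; rewrite linearZ /= del1 scaler0.
- split; first exact: (Leib_irreducible hB hLeib hS hefh hef).
    have bL := Leib_basis hB hLeib hS hefh hef hhe hhf hk b0N eb0 hb0.
    by rewrite -(span_basis bL) (eqnP (basis_free bL)).
  pose b1 := va_anchor X f b0.
  have bA := algebra_basis hB hLeib hS hefh hef hhe hhf hk k0 b0N eb0 hb0.
  have frA := basis_free bA.
  have frW : free [:: b0; b1] by move: frA; rewrite free_cons => /andP[].
  (* The trivial summand consists of the scalars, and the other summand is generated by [b0]. *)
  exists <[1]>%VS, <<[:: b0; b1]>>%VS; split.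
  + by move=> s _ _ /vlineP[c ->]; rewrite anchor_scalar.
  + split.
    * move=> W0; have := free_not0 frW (mem_head _ _); rewrite -memv0 -W0.
      by rewrite memv_span ?mem_head.
    * move=> s w _; exact: (weight_span_stable hB hLeib hS hefh hef hhe hhf hk eb0 hb0).
    * move=> U UW stU.
      apply: (weight_span_simple hef eb0 hb0) => // w wU.
      by split; apply: stU.
  + by apply/eqP.
  + by rewrite -span_seq1 -span_cat (span_basis bA).
  + by move: frA; rewrite -cat1s cat_free span_seq1 => /and3P[].
- split.
    exists <<[:: b0; va_anchor X f b0]>>%VS.
    have maxP := weight_maximal_ideal hB hLeib hS hefh hef hhe hhf hk k0 b0N eb0 hb0.
    by split; [apply/maxP | move=> M /maxP].
move=> W a0 [_ stW _] dimW a0W /eqP a0N ea0 ha0 a1.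
have bA := algebra_basis hB hLeib hS hefh hef hhe hhf hk k0 a0N ea0 ha0.
have [[? ? ?] [? ? ?]] := sl2_actions hB hLeib hS hefh hef hhe hhf hk k0 a0N ea0 ha0.
have [? ? ? ?] := weight_del_actions hB hLeib hS hefh hef hhe hhf hk k0 a0N ea0 ha0.
split=> //.
- split=> //; last exact: (Leib_basis hB hLeib hS hefh hef hhe hhf hk a0N ea0 ha0).
  (* [W] is a given submodule: it contains [a0] and [a1], which are independent, and its dimension
     is 2. *)
  have frW : free [:: a0; a1] by have := basis_free bA; rewrite free_cons => /andP[].
  rewrite basisEfree frW dimW leqnn andbT /=; apply/span_subvP => w.
  by rewrite !inE => /pred2P[] ->; rewrite ?stW.
- exact: (del_pairings hB hLeib hS hefh hef hhe hhf hk ea0 ha0).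
- exact: (weight_products hB hLeib hS hefh hef hhe hhf hk k0 a0N ea0 ha0).
Qed.
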